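(* Let $n,d\ge 1$ be integers, and suppose that $p$ points of $\mathbb{R}^d$ arriving in a stream are summarized by the merge-and-reduce coreset tree with node size $n$ (as defined in the context). Then the time complexity for a complete collapse of the tree to a single coreset of size $n\times d$ is $\mathcal{O}(p d^2)$. Consequently the average time complexity per point is constant, i.e. it is $\mathcal{O}(d^2)$, which does not depend on $p$ (and is $\mathcal{O}(1)$ when $d$ is regarded as a constant).
   Context: Merge-and-reduce coreset tree with node size $n$. Points (row vectors) of $\mathbb{R}^d$ arrive one after another. Each block of $n$ consecutive points forms a leaf $C_i\in\mathbb{R}^{n\times d}$, which is inserted as a node of level $0$. Whenever two adjacent nodes of the same level $\ell$ are present in memory, they are merged: their $n\times d$ matrices are stacked into a $2n\times d$ matrix, this matrix is compressed to an $n\times d$ matrix (a coreset, computed via a singular value decomposition), the result is stored as a single node of level $\ell+1$, and the two merged nodes are deleted from memory. Merging is repeated until no two nodes in memory have the same level. The tree is completely collapsed when only one node (the root), an $n\times d$ matrix, remains in memory; this happens when the number of points received is $p=n2^{q_0}$ for an integer $q_0\ge 0$. Cost model: the time for a complete collapse is the total time of all compressions performed from the first point until the collapse, and each compression of a $2n\times d$ matrix to an $n\times d$ matrix by singular value decomposition takes time $\mathcal{O}(nd^2)$. The average time per point is the total time divided by $p$. The symbol $\mathcal{O}$ hides an absolute constant, independent of $n$, $d$ and $p$. *)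

(* Defs.v *)
From HB Require Import structures.
From mathcomp Require Import all_boot all_order all_algebra.
From mathcomp Require Import reals.

Set Implicit Arguments.
Unset Strict Implicit.
Unset Printing Implicit Defensive.

Import Order.TTheory GRing.Theory Num.Theory.
Local Open Scope ring_scope.

(* Full SVD A = U D V^T.  The order of the singular values on the diagonal of
   the rectangular matrix D is not prescribed. *)
Definition is_svd (R : realType) (m d : nat) (A : 'M[R]_(m, d))
    (UDV : 'M[R]_m * 'M[R]_(m, d) * 'M[R]_d) : Prop :=
  let: (U, D, V) := UDV in
  [/\ U^T *m U = 1%:M, V^T *m V = 1%:M,
      forall (i : 'I_m) (j : 'I_d), (i : nat) != j -> D i j = 0,
      forall i j, 0 <= D i j
    & A = U *m D *m V^T].

(* A compression routine, given uniformly in n and d: it reads off an n x d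
   coreset from an SVD of a 2n x d matrix.  The read-off rule is left arbitrary.
   [time] is the running time of one whole compression (SVD and read-off), and
   may depend on the entries of the matrix. *)
Record svd_compressor (R : realType) := SvdCompressor {
  svd : forall n d : nat,
    'M[R]_(n + n, d) -> 'M[R]_(n + n) * 'M[R]_(n + n, d) * 'M[R]_d;
  svdP : forall (n d : nat) (A : 'M[R]_(n + n, d)), is_svd A (svd A);
  coreset_of_svd : forall n d : nat,
    'M[R]_(n + n) * 'M[R]_(n + n, d) * 'M[R]_d -> 'M[R]_(n, d);
  time : forall n d : nat, 'M[R]_(n + n, d) -> R;
  time_ge0 : forall (n d : nat) (A : 'M[R]_(n + n, d)), 0 <= time A
}.

Definition compress (R : realType) (K : svd_compressor R) (n d : nat)
    (A : 'M[R]_(n + n, d)) : 'M[R]_(n, d) :=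
  coreset_of_svd K (svd K A).

(* One compression takes time O(n d^2), with a constant independent of n, d. *)
Definition compression_time_bigO (R : realType) (K : svd_compressor R) : Prop :=
  exists2 c : R, 0 <= c &
    forall (n d : nat) (A : 'M[R]_(n + n, d)), (0 < n)%N -> (0 < d)%N ->
      time K A <= c * (n%:R * d%:R ^+ 2).

Record node (R : realType) (n d : nat) := Node {
  level : nat;
  coreset : 'M[R]_(n, d)
}.

Definition merge (R : realType) (K : svd_compressor R) (n d : nat)
    (u v : node R n d) : node R n d :=
  Node (level u).+1 (compress K (col_mx (coreset u) (coreset v))).

Definition merge_time (R : realType) (K : svd_compressor R) (n d : nat)
    (u v : node R n d) : R :=
  time K (col_mx (coreset u) (coreset v)).

(* Nodes are listed from the oldest to the most recent.  [merge_once] merges the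
   first two adjacent nodes of equal level, and returns the new list with the
   time spent; without such a pair it returns the list unchanged and time 0. *)
Fixpoint merge_once (R : realType) (K : svd_compressor R) (n d : nat)
    (s : seq (node R n d)) : seq (node R n d) * R :=
  match s with
  | u :: s1 =>
      match s1 with
      | v :: s2 =>
          if level u == level v then (merge K u v :: s2, merge_time K u v)
          else let: (s', t) := merge_once K s1 in (u :: s', t)
      | [::] => (s, 0)
      end
  | [::] => (s, 0)
  end.

(* Merging until no merge is possible: every merge removes one node, so that
   [size s] rounds are enough. *)
Definition merge_all (R : realType) (K : svd_compressor R) (n d : nat)
    (s : seq (node R n d)) : seq (node R n d) * R :=
  iter (size s)
    (fun st => let: (s', t) := merge_once K st.1 in (s', st.2 + t)) (s, 0).

(* [buffer] holds the points of the current, still incomplete, block;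
   [elapsed] is the total time of the compressions performed so far. *)
Record state (R : realType) (n d : nat) := State {
  buffer : seq 'rV[R]_d;
  memory : seq (node R n d);
  elapsed : R
}.

Definition leaf (R : realType) (n d : nat) (b : seq 'rV[R]_d) : node R n d :=
  Node 0 (\matrix_(i < n) nth 0 b i).

Definition receive (R : realType) (K : svd_compressor R) (n d : nat)
    (st : state R n d) (x : 'rV[R]_d) : state R n d :=
  let b := rcons (buffer st) x in
  if size b == n then
    let: (s, t) := merge_all K (rcons (memory st) (leaf n b)) in
    State [::] s (elapsed st + t)
  else State b (memory st) (elapsed st).

Definition run (R : realType) (K : svd_compressor R) (n d : nat)
    (xs : seq 'rV[R]_d) : state R n d :=
  foldl (@receive R K n d) (State [::] [::] 0) xs.

Definition collapsed (R : realType) (n d : nat) (st : state R n d) : Prop :=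
  buffer st = [::] /\ size (memory st) = 1%N.

Definition total_time (R : realType) (K : svd_compressor R) (n d : nat)
    (xs : seq 'rV[R]_d) : R :=
  elapsed (run K n xs).

Definition average_time (R : realType) (K : svd_compressor R) (n d : nat)
    (xs : seq 'rV[R]_d) : R :=
  total_time K n xs / (size xs)%:R.

(* Main.v *)
(* Give a node of level l the weight 2 ^ l.  A merge preserves the total weight
   of the memory, so this weight is the number of blocks received.  As merging
   leaves strictly decreasing levels, the memory is the binary expansion of that
   number, hence a single node exactly when it is a power of 2.  A merge also
   removes one node and each block adds one, so the number of merges so far is
   the weight minus the number of nodes: at most p / n compressions of cost
   O(n d^2) each. *)
Require Import Defs.
From HB Require Import structures.
From mathcomp Require Import all_boot all_order all_algebra.
From mathcomp Require Import reals.
From mathcomp Require Import zify lra.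

Set Implicit Arguments.
Unset Strict Implicit.
Unset Printing Implicit Defensive.

Import Order.TTheory GRing.Theory Num.Theory.
Local Open Scope ring_scope.

Section MergeAndReduce.

Variables (R : realType) (K : svd_compressor R) (n d : nat).
Implicit Types (s : seq (node R n d)) (xs : seq 'rV[R]_d).

Definition levels s : seq nat := [seq level u | u <- s].

Definition weight s : nat := (\sum_(u <- s) 2 ^ level u)%N.

Lemma weight_cons u s : weight (u :: s) = (2 ^ level u + weight s)%N.
Proof. by rewrite /weight big_cons. Qed.

Lemma weight_rcons s u : weight (rcons s u) = (weight s + 2 ^ level u)%N.
Proof. by rewrite /weight -cats1 big_cat big_seq1. Qed.

(** Unfolds with projections instead of a destructuring [let], so that induction hypotheses on the
    tail rewrite directly. *)
Lemma merge_once_cons2 u v s :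
  merge_once K (u :: v :: s) =
  if level u == level v then (Defs.merge K u v :: s, merge_time K u v)
  else (u :: (merge_once K (v :: s)).1, (merge_once K (v :: s)).2).
Proof. by case E: (merge_once K (v :: s)) => [s' t]; move: E => /= ->. Qed.

Local Arguments merge_once : simpl never.

Lemma weight_merge_once s : weight (merge_once K s).1 = weight s.
Proof.
elim: s => [|u [|v s] IHs] //; rewrite merge_once_cons2.
case: eqP => [uv|_]; last by rewrite /= weight_cons IHs [in RHS]weight_cons.
by rewrite !weight_cons /= uv expnS; lia.
Qed.

(** Progress measure for the iteration: a round that changes nothing finds no equal neighbours, and
    any other round costs exactly one node. *)
Lemma merge_onceP s :
  if sorted (fun i j => i != j) (levels s) then merge_once K s = (s, 0)
  else size s = (size (merge_once K s).1).+1.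
Proof.
elim: s => [|u [|v s] IHs] //; rewrite merge_once_cons2.
rewrite [sorted _ _]/=; case: eqP => //= _.
by move: IHs => /=; case: path => [->|<-].
Qed.

(* The bound grows by one because the pair merged may be the first one. *)
Lemma path_merge_once m s :
  path geq m (levels s) -> path geq m.+1 (levels (merge_once K s).1).
Proof.
elim: s m => [|u [|v s] IHs] m //; first by rewrite /= !andbT => /leqW.
rewrite merge_once_cons2 => /= /and3P[um vu vs]; case: eqP => [uv|/eqP uv] /=.
  rewrite ltnS um /= uv.
  by case: (s) vs => //= w s1 /andP[wv ->]; rewrite leqW.
(* A merge in the tail can raise its head to at most [(level v).+1], which stays below [level u]
   because [level v < level u] here. *)
have := IHs (level v); rewrite /= leqnn vs => /(_ isT).
set s' := (merge_once K (v :: s)).1.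
rewrite leqW //=; case: s' => //= w s1 /andP[wv ->]; rewrite andbT.
by rewrite (leq_trans wv) // ltn_neqAle eq_sym uv.
Qed.

Lemma sorted_merge_once s :
  sorted geq (levels s) -> sorted geq (levels (merge_once K s).1).
Proof.
case: s => [|u s] // us.
have /path_merge_once/path_sorted // : path geq (level u) (levels (u :: s)).
by rewrite /= leqnn.
Qed.

Lemma merge_all_ind (P : seq (node R n d) * R -> Prop) s :
  P (s, 0) ->
  (forall s' t, P (s', t) -> P ((merge_once K s').1, t + (merge_once K s').2)) ->
  P (merge_all K s).
Proof.
move=> P0 PS; rewrite /merge_all; elim: (size s) => //= k.
by case: (iter k _ _) => s' t /PS /=; case: (merge_once K s').
Qed.

Lemma weight_merge_all s : weight (merge_all K s).1 = weight s.
Proof.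
by apply: (merge_all_ind (P := fun r => weight r.1 = weight s)) => //= s' t;
  rewrite weight_merge_once.
Qed.

Lemma merge_all_stable s :
  sorted (fun i j => i != j) (levels (merge_all K s).1).
Proof.
rewrite /merge_all; set f := fun st : seq (node R n d) * R => _.
(* Each round removes a node unless the list is already stable. *)
have: sorted (fun i j => i != j) (levels (iter (size s) f (s, 0)).1) \/
    (size (iter (size s) f (s, 0%R)).1 + size s <= size s)%N.
  (* Only the last [size s] is kept: after [k] rounds the list is stable or has lost at least [k]
     nodes. *)
  elim: {-4}(size s) => [|k] /=; first by right; rewrite addn0.
  case: (iter k f (s, 0)) => s' t /= IHk; rewrite /f /=.
  have := merge_onceP s'; case: ifP IHk => [ds' _ -> /=|_ [//|sz]]; first by left.
  by case: (merge_once K s') => s'' t' /= sz'; right; lia.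
(* After [size s] rounds the second alternative leaves the empty list, which is stable too. *)
by case=> //; rewrite -[leqRHS]add0n leq_add2r leqn0 => /nilP ->.
Qed.

(** Merging keeps the levels nonincreasing, and stability excludes equal neighbours. *)
Lemma sorted_merge_all s :
  sorted geq (levels s) -> sorted gtn (levels (merge_all K s).1).
Proof.
move=> ges; rewrite (@eq_sorted _ _ [rel i j | geq i j && (i != j)]); last first.
  by move=> i j /=; rewrite ltn_neqAle andbC eq_sym.
rewrite sorted_relI merge_all_stable andbT.
by apply: (merge_all_ind (P := fun r => sorted geq (levels r.1))) => //= s' t;
  apply: sorted_merge_once.
Qed.

(** Strictness can be lost, since the last node may already have level [0]. *)
Lemma sorted_gtn_rcons0 s u :
  level u = 0%N -> sorted gtn (levels s) -> sorted geq (levels (rcons s u)).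
Proof.
move=> u0; case: s => //= v s vs; rewrite /levels map_rcons rcons_path /= u0.
by rewrite andbT; apply: sub_path vs => i j /ltnW.
Qed.

(** By induction the tail weighs less than [2 ^ level u], so the whole list weighs less than
    [2 ^ (level u).+1], with [level u < m]. *)
Lemma weight_lt m s : path gtn m (levels s) -> (weight s < 2 ^ m)%N.
Proof.
elim: s m => [|u s IHs] m /=; first by rewrite /weight big_nil expn_gt0.
case/andP => um /IHs; rewrite weight_cons => ws.
by apply: leq_trans (leq_pexp2l _ um); rewrite // expnS; lia.
Qed.

(** The empty list has weight 0, and a second node puts the weight strictly between two consecutive
    powers of 2. *)
Lemma size_weight_exp2 s :
  sorted gtn (levels s) -> (size s = 1 <-> exists q, weight s = 2 ^ q)%N.
Proof.
case: s => [|u s] /=.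
  by split=> // -[q]; rewrite /weight big_nil => /esym/eqP; rewrite expn_eq0.
rewrite weight_cons => us; have := weight_lt us.
case: s us => [|v s] /= us lt_u.
  by split=> // _; exists (level u); rewrite /weight big_nil addn0.
split=> // -[q] wq; move: lt_u.
have: (0 < weight (v :: s))%N by rewrite weight_cons addn_gt0 expn_gt0.
move=> w_gt0 w_lt.
have : (2 ^ level u < 2 ^ q < 2 ^ (level u).+1)%N.
  by rewrite -wq expnS; lia.
by rewrite !ltn_exp2l //; lia.
Qed.

(** Euclidean division of the number of points by [n]: the weight is the quotient, the buffer size
    the remainder. *)
Lemma run_invariant xs : (0 < n)%N ->
  [/\ size xs = (n * weight (memory (run K n xs)) + size (buffer (run K n xs)))%N,
      (size (buffer (run K n xs)) < n)%N
    & sorted gtn (levels (memory (run K n xs)))].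
Proof.
move=> n_gt0; elim/last_ind: xs => [|xs x].
  by rewrite /= /weight big_nil muln0.
rewrite /run foldl_rcons -/(run K n xs); case: (run K n xs) => b s e /=.
rewrite size_rcons => -[szxs ltb ds]; rewrite /receive /= size_rcons szxs.
case: eqP => [szb|/eqP szb]; last first.
  by rewrite /= size_rcons addnS ltn_neqAle szb.
have := weight_merge_all (rcons s (leaf n (rcons b x))).
have := sorted_merge_all
  (sorted_gtn_rcons0 (erefl : level (leaf n (rcons b x)) = 0%N) ds).
case: (merge_all _ _) => s' t /= ds' ->.
by split=> //; rewrite weight_rcons /=; lia.
Qed.

Lemma collapsedP xs : (0 < n)%N ->
  collapsed (run K n xs) <-> exists q, size xs = (n * 2 ^ q)%N.
Proof.
move=> n_gt0; have [szxs ltb /size_weight_exp2 sz1] := run_invariant xs n_gt0.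
rewrite /collapsed szxs; split=> [[-> /sz1[q ->]]|[q e]].
  by exists q; rewrite addn0.
(* Both sides of [e] are reduced modulo [n]; the buffer, shorter than [n], is its own residue. *)
have b0 : size (buffer (run K n xs)) = 0%N.
  by have := congr1 (modn^~ n) e; rewrite mulnC modnMDl mulnC modnMl modn_small.
split; first exact: size0nil.
apply/sz1; exists q; apply/eqP.
by rewrite -(eqn_pmul2l n_gt0) -e b0 addn0.
Qed.

Variable B : R.
Hypothesis time_le : forall A : 'M[R]_(n + n, d), time K A <= B.

(** Amortization: every node carries a credit [B], and the node that a merge removes pays for its
    compression. *)
Lemma merge_once_time s :
  (merge_once K s).2 + B * (size (merge_once K s).1)%:R <= B * (size s)%:R.
Proof.
elim: s => [|u [|v s] IHs]; rewrite ?add0r // merge_once_cons2.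
case: ifP => _; last by rewrite /= -natr1 -[in leRHS]natr1 !mulrDr !mulr1 addrA lerD2r.
by rewrite /= -[in leRHS]natr1 mulrDr mulr1 addrC lerD2l time_le.
Qed.

Lemma merge_all_time s :
  (merge_all K s).2 + B * (size (merge_all K s).1)%:R <= B * (size s)%:R.
Proof.
apply: (merge_all_ind (P := fun r => r.2 + B * (size r.1)%:R <= B * (size s)%:R))
  => [|s' t /= /(le_trans _)]; rewrite ?add0r //; apply.
by rewrite -addrA lerD2l merge_once_time.
Qed.

(** A new leaf adds 1 to both weight and size; afterwards merging preserves the weight and is paid
    by the credits. *)
Lemma elapsed_run xs :
  elapsed (run K n xs) + B * (size (memory (run K n xs)))%:R
    <= B * (weight (memory (run K n xs)))%:R.
Proof.
elim/last_ind: xs => [|xs x]; first by rewrite /= /weight big_nil mulr0 addr0.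
rewrite /run foldl_rcons -/(run K n xs); case: (run K n xs) => b s e /= IH.
rewrite /receive /=; case: eqP => [_|//] /=.
have := weight_merge_all (rcons s (leaf n (rcons b x))).
have := merge_all_time (rcons s (leaf n (rcons b x))).
case: (merge_all _ _) => s' t /= t_le ->.
move: t_le; rewrite weight_rcons size_rcons /= expn0 addn1 -!natr1 !mulrDr mulr1.
lra.
Qed.

End MergeAndReduce.

Theorem theorem4 (R : realType) (K : svd_compressor R)
    (hK : compression_time_bigO K) :
  [/\ (forall (n d p : nat) (x : p.-tuple 'rV[R]_d),
         (0 < n)%N -> (0 < d)%N ->
         (collapsed (run K n x) <-> exists q0 : nat, p = (n * 2 ^ q0)%N)),
      (exists2 C : R, 0 <= C &
         forall (n d p : nat) (x : p.-tuple 'rV[R]_d),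
           (0 < n)%N -> (0 < d)%N -> collapsed (run K n x) ->
           total_time K n x <= C * (p%:R * d%:R ^+ 2)),
      (exists2 C : R, 0 <= C &
         forall (n d p : nat) (x : p.-tuple 'rV[R]_d),
           (0 < n)%N -> (0 < d)%N -> collapsed (run K n x) ->
           average_time K n x <= C * d%:R ^+ 2)
    & (forall d : nat, (0 < d)%N -> exists2 C : R, 0 <= C &
         forall (n p : nat) (x : p.-tuple 'rV[R]_d),
           (0 < n)%N -> collapsed (run K n x) ->
           average_time K n x <= C)].
Proof.
have [c c_ge0 time_le] := hK.
have total n d p (x : p.-tuple 'rV[R]_d) : (0 < n)%N -> (0 < d)%N ->
    total_time K n x <= c * (p%:R * d%:R ^+ 2).
  move=> n_gt0 d_gt0; have [szx _ _] := run_invariant K x n_gt0.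
  have := elapsed_run (fun A => time_le n d A n_gt0 d_gt0) x.
  rewrite /total_time; set e := elapsed _; set w := weight _ in szx *.
  set B := c * _ => e_le.
  have B_ge0 : 0 <= B by rewrite !mulr_ge0 // exprn_ge0.
  have {}e_le : e <= B * w%:R.
    by apply: le_trans e_le; rewrite lerDl mulr_ge0.
  (* What remains is [n * w <= p]: complete blocks contain at most all the points. *)
  apply: (le_trans e_le); rewrite /B -mulrA ler_wpM2l // mulrAC ler_wpM2r ?exprn_ge0 //.
  by rewrite -natrM ler_nat -(size_tuple x) szx leq_addr.
have average n d p (x : p.-tuple 'rV[R]_d) : (0 < n)%N -> (0 < d)%N ->
    average_time K n x <= c * d%:R ^+ 2.
  move=> n_gt0 d_gt0; rewrite /average_time size_tuple.
  (* For [p = 0] the quotient is 0, as the inverse of 0 is 0. *)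
  case: p x => [|p] x; first by rewrite invr0 mulr0 mulr_ge0 ?exprn_ge0.
  by rewrite ler_pdivrMr ?ltr0n // -mulrA [_ ^+ 2 * _]mulrC total.
split=> [n d p x n_gt0 d_gt0|||d d_gt0].
- by rewrite collapsedP // size_tuple.
- by exists c => // n d p x n_gt0 d_gt0 _; apply: total.
- by exists c => // n d p x n_gt0 d_gt0 _; apply: average.
- exists (c * d%:R ^+ 2) => [|n p x n_gt0 _]; last exact: average.
  by rewrite mulr_ge0 ?exprn_ge0.
Qed.
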